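(* Let $f\in X=\mathbb{R}^{N\times N}$, let $\hat f\in X$ be the $N\times N$ constant matrix with all coefficients equal to $\frac1{N^2}\sum_{i,j=1}^N f_{i,j}$, let $f_0=f-\hat f$, and let $D_d=\{y\in G_d:\ T_d^\circ(y)\le1\}$. Then the problem $$\inf\{J_d(u)+J_d^*(v):\ (u,v)\in X\times X,\ f=u+v\}$$ is equivalent to the problem $$\inf\{T_d(f_0-v):\ v\in D_d\},$$ i.e., a pair $(f-v,v)$ with $v\in X$ is a minimizer of the first problem if and only if $v$ is a minimizer of the second problem.
   Context: $X=\mathbb{R}^{N\times N}$ is the space of real $N\times N$ matrices with scalar product $\langle u,v\rangle_X=\sum_{i,j=1}^N u_{i,j}v_{i,j}$. The discrete gradient $\nabla:X\to X\times X$ is $(\nabla u)_{i,j}=((\nabla u)^1_{i,j},(\nabla u)^2_{i,j})$, where $(\nabla u)^1_{i,j}=u_{i+1,j}-u_{i,j}$ if $i<N$ and $0$ if $i=N$, and $(\nabla u)^2_{i,j}=u_{i,j+1}-u_{i,j}$ if $j<N$ and $0$ if $j=N$. The discrete total variation is $J_d(u)=\sum_{i,j=1}^N\|(\nabla u)_{i,j}\|$, with $\|\cdot\|$ the Euclidean norm on $\mathbb{R}^2$. Its Legendre transform is $J_d^*(v)=\sup\{\langle u,v\rangle_X-J_d(u):u\in X\}\in[0,\infty]$. Set $G_d=\{u\in X:\sum_{i,j=1}^N u_{i,j}=0\}$; $T_d:G_d\to[0,\infty)$ is the restriction of $J_d$ to $G_d$ (a norm on $G_d$), and $T_d^\circ(y)=\max\{\langle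 x,y\rangle_X:\ x\in G_d,\ T_d(x)\le1\}$ for $y\in G_d$ is its dual norm. *)

(* Defs.v *)
From HB Require Import structures.
From mathcomp Require Import all_boot all_order all_algebra.
From mathcomp Require Import all_classical all_reals all_analysis.

Set Implicit Arguments.
Unset Strict Implicit.
Unset Printing Implicit Defensive.

Import Order.TTheory GRing.Theory Num.Theory.
Local Open Scope classical_set_scope.
Local Open Scope ring_scope.

Definition is_minimizer (T : Type) (d : Order.disp_t) (V : porderType d)
    (A : set T) (F : T -> V) (x : T) : Prop :=
  A x /\ forall y, A y -> (F x <= F y)%O.

Section DiscreteTV.
Variables (R : realType) (N : nat).
Implicit Types u v x y f : 'M[R]_N.

Definition dot u v : R := \sum_(i < N) \sum_(j < N) u i j * v i j.

(* [insub i.+1 : option 'I_N] is [None] exactly when [i] is the last index. *)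
Definition grad1 u : 'M[R]_N :=
  \matrix_(i, j) if insub i.+1 is Some i' then u i' j - u i j else 0.

Definition grad2 u : 'M[R]_N :=
  \matrix_(i, j) if insub j.+1 is Some j' then u i j' - u i j else 0.

Definition grad u : 'M[R]_N * 'M[R]_N := (grad1 u, grad2 u).

(* Written out because the library's norm on ['rV[R]_2] and on [R * R] is the
   sup norm. *)
Definition euclid_norm2 (p : R * R) : R := Num.sqrt (p.1 ^+ 2 + p.2 ^+ 2).

Definition Jd u : R :=
  \sum_(i < N) \sum_(j < N) euclid_norm2 ((grad u).1 i j, (grad u).2 i j).

Definition Jd_conj v : \bar R := ereal_sup [set (dot u v - Jd u)%:E | u in setT].

Definition Gd : set 'M[R]_N := [set u | \sum_(i < N) \sum_(j < N) u i j = 0].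

(* The restriction of [Jd] to [Gd]; the value 0 outside [Gd] plays no role, as
   [Td] is only evaluated on [Gd]. *)
Definition Td : 'M[R]_N -> R := patch (fun=> 0) Gd Jd.

(* [Td] is a norm on [Gd], so for [y] in [Gd] this supremum is a finite,
   attained maximum. *)
Definition Td_dual y : \bar R :=
  ereal_sup [set (dot x y)%:E | x in [set x | Gd x /\ Td x <= 1]].

Definition Dd : set 'M[R]_N := [set y | Gd y /\ (Td_dual y <= 1)%E].

Definition mean_mx f : 'M[R]_N :=
  const_mx ((\sum_(i < N) \sum_(j < N) f i j) / N%:R ^+ 2).

Definition centered f : 'M[R]_N := f - mean_mx f.

End DiscreteTV.

(* Main.v *)
Require Import Defs.
From HB Require Import structures.
From mathcomp Require Import all_boot all_order all_algebra.
From mathcomp Require Import all_classical all_reals all_analysis.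
From mathcomp Require Import lra.

Set Implicit Arguments.
Unset Strict Implicit.
Unset Printing Implicit Defensive.

Import Order.TTheory GRing.Theory Num.Theory.
Local Open Scope classical_set_scope.
Local Open Scope ring_scope.

(** The discrete total variation [Jd] is nonnegative, positively homogeneous
and invariant under the addition of constant matrices.

For a positively homogeneous function the Legendre transform is an indicator
function: scaling [u] scales [dot u v - Jd u], so the supremum defining
[Jd_conj v] is 0 if [dot u v <= Jd u] for all [u], and [+oo] otherwise.  The
domination [dot u v <= Jd u] for all [u] says exactly that [v] is in [Dd]
([DdP]).  Indeed, testing it on constant matrices, where [Jd] vanishes, forces
[v] to have zero sum; conversely, against such a [v] both sides depend on [u]
only modulo constants, so that it suffices to test [u] in [Gd], where
homogeneity reduces the inequality to the unit ball of [Td].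

Hence the first objective at [(f - v, v)] is [Jd (f - v)] for [v] in [Dd] and
[+oo] elsewhere ([Jd_conj_Dd], [Jd_conj_notDd]), and for [v] in [Dd]
translation invariance gives [Jd (f - v) = Td (centered f - v)]
([Td_centeredB]).  The two problems thus have the same objective on [Dd], and
as [0] is in [Dd] the first infimum is finite, so that a minimizer of the first
problem lies in [Dd]. *)

Section DiscreteTVTheory.
Variables (R : realType) (N : nat).
Implicit Types (u v w x y f : 'M[R]_N) (c t : R).

Lemma dotDl x y v : dot (x + y) v = dot x v + dot y v.
Proof.
rewrite /dot -big_split; apply: eq_bigr => i _ /=.
by rewrite -big_split; apply: eq_bigr => j _ /=; rewrite mxE mulrDl.
Qed.

Lemma dotZl t u v : dot (t *: u) v = t * dot u v.
Proof.
rewrite /dot mulr_sumr; apply: eq_bigr => i _.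
by rewrite mulr_sumr; apply: eq_bigr => j _; rewrite mxE mulrA.
Qed.

Lemma dot_const c v : dot (const_mx c) v = c * \sum_(i < N) \sum_(j < N) v i j.
Proof.
rewrite /dot mulr_sumr; apply: eq_bigr => i _.
by rewrite mulr_sumr; apply: eq_bigr => j _; rewrite mxE.
Qed.

Lemma Jd_ge0 u : 0 <= Jd u.
Proof. by apply: sumr_ge0 => i _; apply: sumr_ge0 => j _; exact: sqrtr_ge0. Qed.

Lemma Jd_addc c u : Jd (u + const_mx c) = Jd u.
Proof.
have addcB a b : (a + c) - (b + c) = a - b by rewrite opprD addrACA subrr addr0.
apply: eq_bigr => i _; apply: eq_bigr => j _; rewrite /euclid_norm2 /= !mxE.
by case: insubP => [i' _ _|_]; case: insubP => [j' _ _|_];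
  rewrite ?mxE ?addcB.
Qed.

Lemma Jd_const c : Jd (const_mx c : 'M[R]_N) = 0.
Proof.
rewrite /Jd big1 // => i _; rewrite big1 // => j _.
rewrite /euclid_norm2 /= !mxE.
by case: insubP => [i' _ _|_]; case: insubP => [j' _ _|_];
  rewrite ?mxE ?subrr expr0n addr0 sqrtr0.
Qed.

Lemma JdZ t u : 0 <= t -> Jd (t *: u) = t * Jd u.
Proof.
move=> t0; rewrite /Jd mulr_sumr; apply: eq_bigr => i _.
rewrite mulr_sumr; apply: eq_bigr => j _; rewrite /euclid_norm2 /= !mxE.
rewrite -[t in RHS](ger0_norm t0) -sqrtr_sqr -sqrtrM ?sqr_ge0 //.
rewrite mulrDr -!exprMn.
by case: insubP => [i' _ _|_]; case: insubP => [j' _ _|_];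
  rewrite ?mxE ?mulr0 ?mulrBr ?mulr0.
Qed.

Lemma GdB x y : Gd x -> Gd y -> Gd (x - y).
Proof.
rewrite /Gd /= => x0 y0; under eq_bigr do under eq_bigr do rewrite !mxE.
by under eq_bigr do rewrite sumrB; rewrite sumrB x0 y0 subrr.
Qed.

Lemma GdZ t x : Gd x -> Gd (t *: x).
Proof.
rewrite /Gd /= => x0; under eq_bigr do under eq_bigr do rewrite mxE.
by under eq_bigr do rewrite -mulr_sumr; rewrite -mulr_sumr x0 mulr0.
Qed.

Lemma Gd_centered f : (0 < N)%N -> Gd (centered f).
Proof.
move=> N0; rewrite /Gd /= /centered /mean_mx.
under eq_bigr do under eq_bigr do rewrite !mxE.
under eq_bigr do rewrite sumrB.
rewrite sumrB !sumr_const !card_ord -mulrnA -[_ *+ (N * N)]mulr_natr.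
rewrite natrM -expr2 divfK ?subrr //.
by rewrite sqrf_eq0 pnatr_eq0 -lt0n.
Qed.

Lemma Jd_centeredB f v : Jd (centered f - v) = Jd (f - v).
Proof.
by rewrite -[RHS](Jd_addc (- ((\sum_i \sum_j f i j) / N%:R ^+ 2))) raddfN addrAC.
Qed.

Lemma Td_Gd x : Gd x -> Td x = Jd x.
Proof. by move=> Gx; rewrite /Td patchT // inE. Qed.

Lemma Td_centeredB f v : (0 < N)%N -> Gd v -> Td (centered f - v) = Jd (f - v).
Proof.
move=> N0 Gv; rewrite Td_Gd ?Jd_centeredB //.
by apply: GdB => //; exact: Gd_centered.
Qed.

(** [Dd] is the subdifferential of [Jd] at 0. *)
Lemma DdP v : (0 < N)%N -> Dd v <-> forall u, dot u v <= Jd u.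
Proof.
move=> N0; split=> [[Gv Tv] u|dotJ].
  have dot1 x : Gd x -> Jd x <= 1 -> dot x v <= 1.
    move=> Gx Jx; rewrite -lee_fin; apply: le_trans Tv.
    by apply: ereal_sup_ubound; exists x => //; rewrite /= Td_Gd.
  rewrite -[u](subrK (mean_mx u)) -/(centered u).
  rewrite dotDl dot_const Gv mulr0 addr0 Jd_addc.
  move: (centered u) (Gd_centered u N0) => x Gx.
  rewrite leNgt; apply/negP => Jx.
  (* If [Jd x < dot x v], rescaling by the inverse of their midpoint separates
     the two values strictly by 1; this also covers the case [Jd x = 0]. *)
  pose m := (Jd x + dot x v) / 2.
  have m0 : 0 < m by have := Jd_ge0 x; rewrite /m; lra.
  have : dot (m^-1 *: x) v <= 1.
    apply: dot1; first exact: GdZ.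
    by rewrite JdZ ?invr_ge0 ?(ltW m0) // ler_pdivrMl // /m; lra.
  by rewrite dotZl ler_pdivrMl // /m; lra.
split.
  (* The constant test matrix whose value is the sum of [v] makes the pairing
     the square of that sum. *)
  have := dotJ (const_mx (\sum_i \sum_j v i j)).
  rewrite dot_const Jd_const -expr2 => S0.
  by apply/eqP; rewrite -sqrf_eq0 eq_le S0 sqr_ge0.
apply: ge_ereal_sup => _ [x [Gx Tx] <-]; rewrite lee_fin.
by apply: le_trans (dotJ x) _; rewrite -Td_Gd.
Qed.

Lemma Dd0 : (0 < N)%N -> Dd (0 : 'M[R]_N).
Proof.
move=> N0; apply/(DdP _ N0) => u; suff -> : dot u 0 = 0 by exact: Jd_ge0.
by rewrite /dot big1 // => i _; rewrite big1 // => j _; rewrite mxE mulr0.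
Qed.

Lemma Jd_conj_Dd v : (0 < N)%N -> Dd v -> Jd_conj v = 0%E.
Proof.
move=> N0 /(DdP _ N0) dotJ; apply/eqP; rewrite eq_le; apply/andP; split.
  by apply: ge_ereal_sup => _ [u _ <-]; rewrite lee_fin subr_le0.
apply: ereal_sup_ubound; exists (const_mx 0) => //.
by rewrite dot_const Jd_const mul0r subr0.
Qed.

(** A test matrix [u] with [Jd u < dot u v] can be scaled up to make
[dot u v - Jd u] as large as desired. *)
Lemma Jd_conj_notDd v : (0 < N)%N -> ~ Dd v -> Jd_conj v = +oo%E.
Proof.
move=> N0 /(contra_not (DdP v N0).2)/existsNP[u /negP].
rewrite -ltNge -subr_gt0 => gap0; apply/eqyP => A A0.
have t0 : 0 <= A / (dot u v - Jd u) by rewrite divr_ge0 ?ltW.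
apply: ereal_sup_ubound; exists ((A / (dot u v - Jd u)) *: u) => //.
by rewrite dotZl JdZ // -mulrBr divfK // gt_eqF.
Qed.

End DiscreteTVTheory.

Theorem lemma3p7 (R : realType) (N : nat) (hN : (0 < N)%N) (f v : 'M[R]_N) :
  is_minimizer
    [set p : 'M[R]_N * 'M[R]_N | f = p.1 + p.2]
    (fun p : 'M[R]_N * 'M[R]_N => ((Jd p.1)%:E + Jd_conj p.2)%E)
    (f - v, v)
  <->
  is_minimizer (@Dd R N) (fun w : 'M[R]_N => Td (centered f - w)) v.
Proof.
have objD w : Dd w ->
    ((Jd (f - w))%:E + Jd_conj w)%E = (Td (centered f - w))%:E.
  by move=> Dw; rewrite Jd_conj_Dd // adde0 Td_centeredB //; case: Dw.
split=> [[_ minv]|[Dv minv]].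
  have minD w : Dd w ->
      ((Jd (f - v))%:E + Jd_conj v <= (Td (centered f - w))%:E)%E.
    by move=> Dw; rewrite -objD //; apply: (minv (f - w, w)); rewrite /= subrK.
  have Dv : Dd v.
    apply: contrapT => nDv; have := minD _ (Dd0 _ hN).
    by rewrite Jd_conj_notDd // addey // leye_eq.
  by split=> // w Dw; rewrite -lee_fin -objD //; exact: minD.
split=> [|[u w] /= fuw]; first by rewrite /= subrK.
have -> : u = f - w by rewrite fuw addrK.
have [Dw|nDw] := pselect (Dd w); last by rewrite (Jd_conj_notDd hN nDw) // addey // leey.
by rewrite !objD // lee_fin; exact: minv.
Qed.
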